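(* Algorithm-B (described in the context) decides CIS with run time $O(\delta_1^n)$, where $n$ is the number of vertices of the input graph system and $\delta_1=1.6181\approx(\sqrt{5}+1)/2$. That is, on every graph system $\mathcal{G}$ it returns true if and only if $\mathcal{G}$ has a good independent set, within the stated time.
   Context: A graph system is a tuple $\mathcal{G}=(G_0,G_1,\ldots,G_m)$ with $m\ge 1$, where all $G_i$ are graphs over the same finite vertex set $V$, $G_0$ is an undirected graph without self-loops, and $G_1,\ldots,G_m$ are directed graphs that may contain self-loops. Let $E_i$ be the edge set of $G_i$. Two vertices are conflicting if they are adjacent in $G_0$. For $\Gamma\subseteq V$ and $1\le i\le m$, a vertex $u\in\Gamma$ is $G_i$-good in $\Gamma$ if there is $v\in\Gamma$ (possibly $v=u$) with $(u,v)\in E_i$; it is good in $\Gamma$ if it is $G_i$-good in $\Gamma$ for every $1\le i\le m$, and bad in $\Gamma$ otherwise. A good independent set (GIS) is a non-empty set $\Gamma\subseteq V$ that contains no two conflicting vertices and all of whose vertices are good in $\Gamma$. CIS is the problem: given $\mathcal{G}$, decide whether it has a GIS. The recursive procedure Las-Vegas$(\mathcal{G},X,Y)$, for $X\subseteq Y\subseteq V$, is: (1) if $X$ is not an independent set of $G_0$, return false; (2) remove from $Y$ all vertices that conflict with some vertex of $X$; (3) while there is a bad vertex in $Y$, remove it from $Y$; (4) if $X\not\subseteq Y$ or $Y=\emptyset$, return false; (5) if $Y$ is an independent set of $G_0$, return true; (6) otherwise pick two conflicting vertices $u,v\in Y$; if Las-Vegas$(\mathcal{G},X,Y\setminus\{u\})$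 returns true, return true; else return the result of Las-Vegas$(\mathcal{G},X\cup\{u\},Y\setminus\{v\})$. Algorithm-B, on input $\mathcal{G}$, returns Las-Vegas$(\mathcal{G},\emptyset,V)$. Running times are measured in $n=|V|$; factors polynomial in the number $m$ of directed graphs are suppressed. *)

(* Defs.v *)
From HB Require Import structures.
From mathcomp Require Import all_boot all_order all_algebra.

Set Implicit Arguments.
Unset Strict Implicit.
Unset Printing Implicit Defensive.

Record graph_system (V : finType) := GraphSystem {
  ndir : nat;
  ndir_gt0 : 0 < ndir;
  conflict : rel V;
  conflict_sym : symmetric conflict;
  conflict_irr : irreflexive conflict;
  darc : 'I_ndir -> rel V
}.

Definition independent (V : finType) (G : graph_system V) (S : {set V}) : bool :=
  [forall u in S, forall v in S, ~~ conflict G u v].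

Definition good_for (V : finType) (G : graph_system V) (S : {set V})
    (i : 'I_(ndir G)) (u : V) : bool :=
  [exists v in S, darc i u v].

Definition good (V : finType) (G : graph_system V) (S : {set V}) (u : V) : bool :=
  [forall i : 'I_(ndir G), good_for S i u].

Definition GIS (V : finType) (G : graph_system V) (S : {set V}) : bool :=
  [&& S != set0, independent G S & [forall u in S, good G S u]].

Definition CIS (V : finType) (G : graph_system V) : Prop :=
  exists S : {set V}, GIS G S.

(* Nondeterministic computations with a running time: the list of the
   (result, number of elementary operations) of all possible executions.
   The result [None] marks an execution that does not end normally: its fuel
   ran out, or it had to choose from an empty list. *)
Definition comp (A : Type) := seq (option A * nat).

Definition charge (A : Type) (k : nat) (c : comp A) : comp A :=
  [seq (o.1, k + o.2) | o <- c].

Definition ret (A : Type) (a : A) : comp A := [:: (Some a, 0)].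

Definition abort {A : Type} : comp A := [:: (None, 0)].

Definition bind (A B : Type) (c : comp A) (f : A -> comp B) : comp B :=
  flatten [seq if o.1 is Some a then charge o.2 (f a) else [:: (None, o.2)]
          | o <- c].

Notation "'let!' x := c 'in' d" := (bind c (fun x => d))
  (at level 200, x name, c at level 100, d at level 200,
   format "'[hv' 'let!'  x  :=  c  'in' '/' d ']'").

(* [op k a] evaluates [a] at the cost of [k] elementary operations. *)
Definition op (A : Type) (k : nat) (a : A) : comp A := charge k (ret a).

Definition choose (A : Type) (s : seq A) : comp A :=
  if s is [::] then abort else [seq (Some a, 1) | a <- s].

Definition andM (b : comp bool) (c : comp bool) : comp bool :=
  let! x := b in if x then c else ret false.

Definition notM (b : comp bool) : comp bool := let! x := b in ret (~~ x).

(* Loops over a list; every iteration costs one operation on top of the cost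
   of its body. *)
Fixpoint hasM (T : Type) (p : T -> comp bool) (s : seq T) : comp bool :=
  if s is x :: s' then
    charge 1 (let! b := p x in if b then ret true else hasM p s')
  else ret false.

Fixpoint filterM (T : Type) (p : T -> comp bool) (s : seq T) : comp (seq T) :=
  if s is x :: s' then
    charge 1 (let! b := p x in
              let! r := filterM p s' in
              ret (if b then x :: r else r))
  else ret [::].

(* A set of vertices is a bit vector indexed by [V]: a membership test costs 1,
   building a new set costs [#|V|].  An edge query costs 1. *)
Definition memM (V : finType) (x : V) (S : {set V}) : comp bool :=
  op 1 (x \in S).

Definition conflictM (V : finType) (G : graph_system V) (u v : V) : comp bool :=
  op 1 (conflict G u v).

Definition darcM (V : finType) (G : graph_system V) (i : 'I_(ndir G)) (u v : V) :
    comp bool :=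
  op 1 (darc i u v).

Definition add1M (V : finType) (x : V) (S : {set V}) : comp {set V} :=
  op #|V| (x |: S).

Definition del1M (V : finType) (x : V) (S : {set V}) : comp {set V} :=
  op #|V| (S :\ x).

Definition of_seqM (V : finType) (s : seq V) : comp {set V} :=
  op #|V| [set x in s].

Definition vertex_pairs (V : finType) : seq (V * V) :=
  [seq (u, v) | u <- enum V, v <- enum V].

Definition conflicting_inM (V : finType) (G : graph_system V) (S : {set V})
    (p : V * V) : comp bool :=
  andM (memM p.1 S) (andM (memM p.2 S) (conflictM G p.1 p.2)).

Definition independentM (V : finType) (G : graph_system V) (S : {set V}) :
    comp bool :=
  notM (hasM (conflicting_inM G S) (vertex_pairs V)).

Definition conflictsM (V : finType) (G : graph_system V) (S : {set V}) :
    comp (seq (V * V)) :=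
  filterM (conflicting_inM G S) (vertex_pairs V).

Definition remove_conflictsM (V : finType) (G : graph_system V)
    (X Y : {set V}) : comp {set V} :=
  let! s := filterM (fun y =>
      andM (memM y Y)
        (notM (hasM (fun x => andM (memM x X) (conflictM G x y)) (enum V))))
    (enum V) in
  of_seqM s.

Definition badM (V : finType) (G : graph_system V) (S : {set V}) (u : V) :
    comp bool :=
  hasM (fun i : 'I_(ndir G) =>
      notM (hasM (fun v => andM (memM v S) (darcM i u v)) (enum V)))
    (enum 'I_(ndir G)).

Fixpoint remove_badM (V : finType) (G : graph_system V) (fuel : nat)
    (Y : {set V}) : comp {set V} :=
  if fuel is fuel'.+1 then
    let! bs := filterM (fun u => andM (memM u Y) (badM G Y u)) (enum V) in
    if nilp bs then ret Y
    else
      let! u := choose bs in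
      let! Y' := del1M u Y in
      remove_badM G fuel' Y'
  else abort.

Definition subsetM (V : finType) (X Y : {set V}) : comp bool :=
  notM (hasM (fun x => andM (memM x X) (notM (memM x Y))) (enum V)).

Definition is_emptyM (V : finType) (Y : {set V}) : comp bool :=
  notM (hasM (fun y => memM y Y) (enum V)).

(* [fuel] bounds the recursion depth and the number of rounds of each call of
   [remove_badM]; it has no other effect. *)
Fixpoint las_vegas (V : finType) (G : graph_system V) (fuel : nat)
    (X Y : {set V}) : comp bool :=
  if fuel is fuel'.+1 then charge 1 (
    let! indX := independentM G X in
    if ~~ indX then ret false else
    let! Y1 := remove_conflictsM G X Y in
    let! Y2 := remove_badM G fuel Y1 in
    let! subXY := subsetM X Y2 in
    if ~~ subXY then ret false else
    let! emptyY := is_emptyM Y2 in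
    if emptyY then ret false else
    let! indY := independentM G Y2 in
    if indY then ret true else
    let! cs := conflictsM G Y2 in
    let! p := choose cs in
    let! Yu := del1M p.1 Y2 in
    let! b := las_vegas G fuel' X Yu in
    if b then ret true else
    let! Xu := add1M p.1 X in
    let! Yv := del1M p.2 Y2 in
    las_vegas G fuel' Xu Yv)
  else abort.

Definition algorithm_B (V : finType) (G : graph_system V) (fuel : nat) :
    comp bool :=
  charge (2 * #|V|) (las_vegas G fuel set0 setT).

(* The exact decimal: it exceeds the golden ratio 1.61803..., which absorbs the
   factors polynomial in [#|V|]. *)
Definition delta1 : rat := 1.6181%Q.

(* Main.v *)
(** A good independent set between [X] and [Y] survives every removal made by a
call: a vertex bad in [Y] is bad in all subsets of [Y]. If it avoids [u] it lies
in [Y \ {u}], and otherwise it contains [u], hence avoids [v]. So the call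
answers whether such a set exists. After the removals no vertex of [Y] conflicts
with [X], so the conflicting [u] and [v] lie outside [X]; hence |Y \ X| drops by
at least 1 in the first branch and by at least 2 in the second. The number of
calls thus obeys a Fibonacci recurrence. Each call takes time O(m (n+1)^3), and
the cubic factor is absorbed by the gap between the golden ratio and
[delta1]. *)

From mathcomp Require Import all_boot all_order all_algebra.
From mathcomp Require Import zify ring lra.
Require Import Defs.

Set Implicit Arguments.
Unset Strict Implicit.
Unset Printing Implicit Defensive.

(** * Total correctness with time bounds for nondeterministic computations *)

(* [runs c P T]: [c] has an execution, and every execution ends normally, with a
   result satisfying [P], within [T] operations. *)
Definition runs (A : eqType) (c : comp A) (P : A -> Prop) (T : nat) : Prop :=
  c <> [::] /\
  forall o, o \in c -> exists a, [/\ o.1 = Some a, P a & o.2 <= T].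

Lemma runs_le (A : eqType) (c : comp A) (P : A -> Prop) T T' :
  T <= T' -> runs c P T -> runs c P T'.
Proof.
move=> leT [c0 cP]; split=> // o /cP[a [oa Pa ot]].
by exists a; split=> //; apply: leq_trans leT.
Qed.

Lemma runs_ret (A : eqType) (a : A) (P : A -> Prop) T : P a -> runs (ret a) P T.
Proof. by move=> Pa; split=> // o; rewrite inE => /eqP->; exists a. Qed.

Lemma runs_charge (A : eqType) k (c : comp A) (P : A -> Prop) T :
  runs c P T -> runs (charge k c) P (k + T).
Proof.
case=> c0 cP; split; first by case: c c0 {cP}.
by move=> _ /mapP[o /cP[a [oa Pa ot]] ->]; exists a; rewrite /= leq_add2l.
Qed.

Lemma runs_op (A : eqType) k (a : A) : runs (op k a) (eq a) k.
Proof. by rewrite -{2}[k]addn0; apply/runs_charge/runs_ret. Qed.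

Lemma runs_bind (A B : eqType) (c : comp A) (f : A -> comp B) P Q T1 T2 :
  runs c P T1 -> (forall a, P a -> runs (f a) Q T2) ->
  runs (bind c f) Q (T1 + T2).
Proof.
move=> [c0 cP] fQ; split.
  case: c c0 cP => // o c _ cP; rewrite /bind /=.
  have [a [-> /fQ[fa0 _] _]] := cP o (mem_head _ _).
  by case: (f a) fa0.
move=> o' /flatten_mapP[o /cP[a [-> Pa ot]]] o'P.
have [_ fP] := runs_charge o.2 (fQ _ Pa).
have [b [ob Qb tb]] := fP _ o'P; exists b; split=> //.
by apply: leq_trans tb _; rewrite leq_add2r.
Qed.

Lemma runs_choose (A : eqType) (s : seq A) :
  s <> [::] -> runs (choose s) (fun a => a \in s) 1.
Proof.
case: s => // x s _; split=> // o /mapP[a sa ->].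
by exists a.
Qed.

Lemma runs_notM (c : comp bool) x t :
  runs c (eq x) t -> runs (notM c) (eq (~~ x)) t.
Proof.
move=> cx; rewrite -[t]addn0; apply: runs_bind cx _ => _ <-.
exact: runs_ret.
Qed.

Lemma runs_andM (b c : comp bool) x y t1 t2 :
  runs b (eq x) t1 -> runs c (eq y) t2 ->
  runs (andM b c) (eq (x && y)) (t1 + t2).
Proof.
move=> bx cy; apply: runs_bind bx _ => _ <-.
by case: x => //; apply: runs_ret.
Qed.

Lemma runs_hasM (T : Type) (p : T -> comp bool) (q : pred T) t s :
  (forall x, runs (p x) (eq (q x)) t) ->
  runs (hasM p s) (eq (has q s)) (size s * t.+1).
Proof.
move=> pq; elim: s => [|x s IHs] /=; first exact: runs_ret.
rewrite mulSn addSn -add1n; apply/runs_charge/(runs_bind (pq x)) => _ <-.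
by case: (q x) => //; apply: runs_ret.
Qed.

Lemma runs_filterM (T : eqType) (p : T -> comp bool) (q : pred T) t s :
  (forall x, runs (p x) (eq (q x)) t) ->
  runs (filterM p s) (eq (filter q s)) (size s * t.+1).
Proof.
move=> pq; elim: s => [|x s IHs] /=; first exact: runs_ret.
rewrite mulSn addSn -add1n; apply/runs_charge/(runs_bind (pq x)) => _ <-.
rewrite -[size s * _]addn0; apply: runs_bind IHs _ => _ <-.
exact: runs_ret.
Qed.

(** * Results and costs of the subroutines *)

Section GraphSystem.

Variables (V : finType) (G : graph_system V).
Implicit Types (S X Y Z : {set V}) (u v x y : V).

Let n := #|V|.
Let m := ndir G.

Lemma size_enumV : size (enum V) = n.
Proof. by rewrite -cardE. Qed.

Definition conflicting_in S (p : V * V) : bool :=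
  [&& p.1 \in S, p.2 \in S & conflict G p.1 p.2].

Lemma runs_conflicting_inM S p :
  runs (conflicting_inM G S p) (eq (conflicting_in S p)) 3.
Proof. by apply/(@runs_andM _ _ _ _ 1 2)/(@runs_andM _ _ _ _ 1 1); apply: runs_op. Qed.

Lemma size_vertex_pairs : size (vertex_pairs V) = n * n.
Proof. by rewrite size_allpairs size_enumV. Qed.

Lemma mem_vertex_pairs p : p \in vertex_pairs V.
Proof. by apply/allpairsP; exists p; rewrite !mem_enum; case: p. Qed.

Lemma independentP S :
  reflect {in S &, forall u v, ~~ conflict G u v} (independent G S).
Proof.
apply: (iffP forall_inP) => [indS u v Su Sv | indS u Su].
  by have /forall_inP := indS u Su; apply.
by apply/forall_inP => v; apply: indS.
Qed.

Lemma independentE S :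
  independent G S = ~~ has (conflicting_in S) (vertex_pairs V).
Proof.
apply/independentP/hasPn => [indS p _ | noS u v Su Sv].
  by apply/and3P => -[Su Sv]; apply/negP/indS.
by have := noS (u, v) (mem_vertex_pairs _); rewrite /conflicting_in Su Sv.
Qed.

Lemma runs_independentM S :
  runs (independentM G S) (eq (independent G S)) (n * n * 4).
Proof.
rewrite independentE -size_vertex_pairs.
exact/runs_notM/runs_hasM/runs_conflicting_inM.
Qed.

Lemma runs_conflictsM S :
  runs (conflictsM G S) (eq (filter (conflicting_in S) (vertex_pairs V)))
       (n * n * 4).
Proof.
by rewrite -size_vertex_pairs; apply/runs_filterM/runs_conflicting_inM.
Qed.

Definition remove_conflicts X Y : {set V} :=
  [set y in Y | ~~ [exists x in X, conflict G x y]].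

Lemma runs_remove_conflictsM X Y :
  runs (remove_conflictsM G X Y) (eq (remove_conflicts X Y))
       (n * (1 + n * 3).+1 + n).
Proof.
set q := fun y =>
  (y \in Y) && ~~ has (fun x => (x \in X) && conflict G x y) (enum V).
have ->: remove_conflicts X Y = [set y in filter q (enum V)].
  apply/setP=> y; rewrite !inE mem_filter mem_enum andbT; congr (_ && ~~ _).
  apply/exists_inP/hasP => [[x Xx xy] | [x _ /andP[Xx xy]]]; exists x => //.
    by rewrite mem_enum.
  by rewrite Xx.
rewrite -{1 2}size_enumV.
apply: runs_bind (runs_filterM _ _) _ => [y | _ <-]; last exact: runs_op.
apply: runs_andM; first exact: runs_op.
by apply/runs_notM/runs_hasM => x; apply: (@runs_andM _ _ _ _ 1 1); apply: runs_op.
Qed.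

Lemma goodE S u :
  good G S u =
  ~~ has (fun i => ~~ has (fun v => (v \in S) && darc i u v) (enum V))
         (enum 'I_m).
Proof.
apply/forallP/hasPn => [gS i _ | gS i].
  have /exists_inP[v Sv uv] := gS i; rewrite negbK; apply/hasP.
  by exists v; rewrite ?mem_enum ?Sv.
have /negPn/hasP[v _ /andP[Sv uv]] := gS i (mem_enum _ _).
by apply/exists_inP; exists v.
Qed.

Lemma runs_badM S u :
  runs (badM G S u) (eq (~~ good G S u)) (m * (n * 3).+1).
Proof.
rewrite goodE negbK -[X in X * _](size_enum_ord m) -size_enumV.
apply: runs_hasM => i; apply/runs_notM/runs_hasM => v.
by apply: (@runs_andM _ _ _ _ 1 1); apply: runs_op.
Qed.

Lemma good_sub S Y u : S \subset Y -> good G S u -> good G Y u.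
Proof.
move=> sSY /forallP gS; apply/forallP => i; have /exists_inP[v Sv uv] := gS i.
by apply/exists_inP; exists v => //; apply: (subsetP sSY).
Qed.

Definition round_cost := n * (1 + m * (n * 3).+1).+1 + (1 + n).

(** A property rather than a function of [Y], because the bad vertices are removed in a
    nondeterministic order. Maximality is demanded only against good independent sets, which is all
    that correctness requires. *)
Definition good_core Y Z : Prop :=
  [/\ Z \subset Y, {in Z, forall u, good G Z u}
    & forall S, GIS G S -> S \subset Y -> S \subset Z].

(** Each round but the last deletes a vertex, and the last one finds no bad vertex: hence at most
    [#|Y|.+1] rounds, and as much fuel. *)
Lemma runs_remove_badM fuel Y : #|Y| < fuel ->
  runs (remove_badM G fuel Y) (good_core Y) (#|Y|.+1 * round_cost).
Proof.
elim: fuel Y => // fuel IH Y ltY /=.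
set q := fun u => (u \in Y) && ~~ good G Y u.
rewrite mulSn /round_cost -addnA -/round_cost.
have filterP : runs (filterM (fun u => andM (memM u Y) (badM G Y u)) (enum V))
    (eq (filter q (enum V))) (n * (1 + m * (n * 3).+1).+1).
  rewrite -{1}size_enumV; apply: runs_filterM => u.
  by apply: runs_andM; [apply: runs_op | apply: runs_badM].
apply: runs_bind filterP _ => _ <-.
case: nilP => [/eqP bs0 | /eqP bsN0].
  apply: runs_ret; split=> // u Yu; apply: contraTT bs0 => badu.
  by rewrite -has_filter; apply/hasP; exists u; rewrite ?mem_enum // /q Yu.
rewrite -addnA; apply: runs_bind (runs_choose _) _ => [|u]; first exact/eqP.
rewrite mem_filter => /andP[/andP[Yu badu] _].
apply: runs_bind (runs_op _ _) _ => _ <-.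
have cardY : #|Y| = (#|Y :\ u|).+1 by rewrite (cardsD1 u) Yu.
have [|_0 runsP] := IH (Y :\ u); first by rewrite -ltnS -cardY.
split=> // o /runsP[Z [oZ [sZY goodZ maxZ] ot]].
exists Z; split=> //; last by rewrite cardY.
split=> //; first exact: subset_trans sZY (subsetDl _ _).
(* Goodness is monotone in the set, so [S] cannot contain the bad vertex [u]. *)
move=> S gisS sSY; apply: maxZ => //; rewrite subsetD1 sSY /=.
apply: contra badu => Su; apply: good_sub sSY _.
by case/and3P: gisS => _ _ /forall_inP; apply.
Qed.

Lemma runs_subsetM X Y : runs (subsetM X Y) (eq (X \subset Y)) (n * 3).
Proof.
have ->: (X \subset Y) = ~~ has (fun x => (x \in X) && (x \notin Y)) (enum V).
  apply/subsetP/hasPn => [sXY x _ | sXY x Xx].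
    by apply/negP => /andP[/sXY->].
  by have := sXY x (mem_enum _ _); rewrite Xx /= negbK.
rewrite -size_enumV; apply/runs_notM/runs_hasM => x.
by apply: (@runs_andM _ _ _ _ 1 1); [|apply: runs_notM]; apply: runs_op.
Qed.

Lemma runs_is_emptyM Y : runs (is_emptyM Y) (eq (Y == set0)) (n * 2).
Proof.
have ->: (Y == set0) = ~~ has (mem Y) (enum V).
  apply/eqP/hasPn => [-> x _ | Y0]; first by rewrite !inE.
  by apply/setP=> y; rewrite inE; apply/negbTE/Y0; rewrite mem_enum.
by rewrite -size_enumV; apply/runs_notM/runs_hasM => y; apply: runs_op.
Qed.

(** * Cost of one call and number of calls *)

(** The summands follow the order of the operations in a call, recursive calls excluded. The final
    [1 + (n + (n + n))] pays for choosing a conflicting pair and for the three set updates. *)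
Definition call_cost : nat :=
  1 + (n * n * 4 + ((n * (1 + n * 3).+1 + n) + (n.+1 * round_cost +
  (n * 3 + (n * 2 + (n * n * 4 + (n * n * 4 + (1 + (n + (n + n)))))))))).

Lemma call_cost_le : call_cost <= 40 * m * n.+1 ^ 3.
Proof.
have m_gt0 : 0 < m := ndir_gt0 G.
rewrite /call_cost /round_cost !expnS expn0; move: n m m_gt0 => k [//|l] _.
nia.
Qed.

(** Equal to 2 F(k+1) - 1 for the Fibonacci numbers with F(1) = F(2) = 1. A call with at most one
    vertex in [Y :\: X] does not branch, whence the two base values. *)
Fixpoint calls (k : nat) : nat :=
  if k is k'.+1 then if k' is k''.+1 then 1 + (calls k' + calls k'') else 1
  else 1.

Lemma callsSS k : calls k.+2 = 1 + (calls k.+1 + calls k).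
Proof. by []. Qed.

Lemma calls_homo : {homo calls : j k / j <= k}.
Proof.
apply: homo_leq => [//|j k l|k]; first exact: leq_trans.
by case: k => // k; rewrite callsSS; lia.
Qed.

(** * Correctness and running time of the recursion *)

Definition GIS_between X Y : bool :=
  [exists S : {set V}, [&& GIS G S, X \subset S & S \subset Y]].

Lemma GIS_betweenP X Y :
  reflect (exists S, [/\ GIS G S, X \subset S & S \subset Y]) (GIS_between X Y).
Proof.
by apply: (iffP existsP) => -[S H]; exists S; apply/and3P.
Qed.

Lemma GIS_independent S : GIS G S -> independent G S.
Proof. by case/and3P. Qed.

Lemma independent_sub S X : X \subset S -> independent G S -> independent G X.
Proof.
move=> /subsetP sXS /independentP indS; apply/independentP => u v Xu Xv.
exact: indS (sXS _ Xu) (sXS _ Xv).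
Qed.

(** A good independent set containing [X] has no vertex in conflict with [X], so it survives the
    first removal; maximality of the core covers the second. *)
Lemma GIS_between_core X Y Z :
  good_core (remove_conflicts X Y) Z -> GIS_between X Y = GIS_between X Z.
Proof.
move=> [sZY _ maxZ]; apply/GIS_betweenP/GIS_betweenP => -[S [gisS sXS sSY]];
  exists S; split=> //.
  apply: maxZ => //; apply/subsetP => y Sy; rewrite inE (subsetP sSY) //=.
  apply/exists_inP => -[x Xx]; apply/negP.
  by have /independentP := GIS_independent gisS; apply=> //; apply: (subsetP sXS).
apply: subset_trans (subset_trans sSY sZY) _.
by apply/subsetP => y; rewrite inE => /andP[].
Qed.

Lemma GIS_between_branch X Y u v : u \in Y -> conflict G u v ->
  GIS_between X Y = GIS_between X (Y :\ u) || GIS_between (u |: X) (Y :\ v).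
Proof.
move=> Yu uv; apply/GIS_betweenP/orP => [[S [gisS sXS sSY]] | ].
  have [Su | S'u] := boolP (u \in S); [right | left]; apply/GIS_betweenP;
    exists S; split; rewrite ?subsetD1 ?subUset ?sub1set ?Su ?sSY //=.
  have /independentP indS := GIS_independent gisS.
  by apply: contraL uv; apply: indS.
case=> /GIS_betweenP[S [gisS sXS]]; rewrite subsetD1 => /andP[sSY _];
  exists S; split=> //.
by move: sXS; rewrite subUset => /andP[].
Qed.

#[local] Arguments remove_badM : simpl never.

(** Two measures are at work: [#|Y|] drops in both branches and controls the fuel, while
    [#|Y :\: X|] controls the time. *)
Lemma runs_las_vegas fuel X Y : X \subset Y -> #|Y| < fuel ->
  runs (las_vegas G fuel X Y) (eq (GIS_between X Y))
       (call_cost * calls #|Y :\: X|).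
Proof.
elim: fuel X Y => // fuel IH X Y sXY ltY /=.
(* Here [Z] stands for what the removals leave of [Y]. The bounds are stated with [Y], since [calls]
   is monotone and [Z :\: X] is no larger than [Y :\: X]. *)
have {IH} branch Z u v : Z \subset Y -> X \subset Z -> u \in Z -> v \in Z ->
    u \notin X -> v \notin X -> conflict G u v ->
    [/\ runs (las_vegas G fuel X (Z :\ u)) (eq (GIS_between X (Z :\ u)))
             (call_cost * calls #|Y :\: X|.-1),
        runs (las_vegas G fuel (u |: X) (Z :\ v))
             (eq (GIS_between (u |: X) (Z :\ v)))
             (call_cost * calls #|Y :\: X|.-2) & 1 < #|Y :\: X| ].
  move=> sZY sXZ Zu Zv X'u X'v uv.
  have ltZ w : w \in Z -> #|Z :\ w| < fuel.
    move=> Zw; have := subset_leq_card sZY; rewrite (cardsD1 w Z) Zw.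
    by move: ltY; lia.
  have neq_uv : u != v by apply: contraTneq uv => ->; rewrite conflict_irr.
  have cardZ : #|Z :\: X| = (#|(Z :\ v) :\: (u |: X)|).+2.
    rewrite (cardsD1 u) (cardsD1 v) !inE X'u Zu X'v Zv eq_sym neq_uv /=.
    congr (_.+2); apply: eq_card => w; rewrite !inE.
    by case: (w == u); case: (w == v); case: (w \in X).
  have cardZu : #|Z :\: X| = (#|(Z :\ u) :\: X|).+1.
    rewrite (cardsD1 u) !inE X'u Zu /=.
    congr (_.+1); apply: eq_card => w; rewrite !inE.
    by case: (w == u); case: (w \in X).
  have leZY : #|Z :\: X| <= #|Y :\: X| by apply/subset_leq_card/setSD.
  split; last by rewrite (leq_trans _ leZY) ?cardZ.
    apply: runs_le (IH _ _ _ (ltZ u Zu)); last by rewrite subsetD1 sXZ.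
    by rewrite leq_mul2l calls_homo ?orbT //; lia.
  apply: runs_le (IH _ _ _ (ltZ v Zv)).
    by rewrite leq_mul2l calls_homo ?orbT //; lia.
  rewrite subsetD1 subUset sub1set Zu sXZ /= !inE negb_or X'v andbT.
  by rewrite eq_sym.
(* [d] is the time left for the recursive calls. *)
have [d [leT ltd]] : exists d, call_cost + d <= call_cost * calls #|Y :\: X| /\
   (1 < #|Y :\: X| -> call_cost * calls #|Y :\: X|.-1 +
                      call_cost * calls #|Y :\: X|.-2 <= d).
  case: #|Y :\: X| => [|[|k]];
    [exists 0 | exists 0 | exists (call_cost * (calls k.+1 + calls k))];
    rewrite ?addn0 ?muln1 //=.
  by rewrite -[1 + _]/(1 + (calls k.+1 + calls k)) !mulnDr muln1.
apply: runs_le leT _; rewrite /call_cost.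
move bad_costE: (n.+1 * round_cost) => bad_cost; rewrite -!addnA; apply: runs_charge.
apply: runs_bind (runs_independentM X) _ => _ <-.
case: ifPn => [depX | /negPn indX].
  apply: runs_ret; apply/negbTE; apply: contra depX => /GIS_betweenP[S].
  by case=> /GIS_independent indS sXS _; apply: independent_sub indS.
rewrite (addnA (n * _) n).
apply: runs_bind (runs_remove_conflictsM X Y) _ => _ <-.
set Y1 := remove_conflicts X Y.
have sY1Y : Y1 \subset Y by apply/subsetP => y; rewrite inE => /andP[].
have badP : runs (remove_badM G fuel.+1 Y1) (good_core Y1) bad_cost.
  rewrite -bad_costE; apply: runs_le (runs_remove_badM _).
    by rewrite leq_mul2r ltnS max_card orbT.
  by apply: leq_ltn_trans ltY; apply: subset_leq_card.
apply: runs_bind badP _ => Z coreZ; rewrite (GIS_between_core coreZ).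
have [sZY1 goodZ _] := coreZ.
apply: runs_bind (runs_subsetM X Z) _ => _ <-.
case: ifPn => [nsXZ | /negPn sXZ].
  apply: runs_ret; apply/negbTE; apply: contra nsXZ => /GIS_betweenP[S].
  by case=> _; apply: subset_trans.
apply: runs_bind (runs_is_emptyM Z) _ => _ <-.
case: eqP => [Z0 | /eqP ZN0].
  apply: runs_ret; apply/negbTE/GIS_betweenP => -[S [/and3P[/negP SN0 _ _] _]].
  by rewrite Z0 subset0.
apply: runs_bind (runs_independentM Z) _ => _ <-.
case: ifPn => [indZ | depZ].
  apply: runs_ret; apply/GIS_betweenP; exists Z; split=> //.
  by rewrite /GIS ZN0 indZ; apply/forall_inP.
apply: runs_bind (runs_conflictsM Z) _ => _ <-.
apply: runs_bind (runs_choose _) _ => [|[u v]].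
  by apply/eqP; rewrite -has_filter -[has _ _]negbK -independentE.
rewrite mem_filter /= => /andP[/and3P[/= Zu Zv uv] _].
have X'conf w z : z \in Z -> conflict G w z -> w \notin X.
  move=> /(subsetP sZY1); rewrite inE => /andP[_ noX] wz.
  by apply: contra noX => Xw; apply/exists_inP; exists w.
have [runs1 runs2 /ltd le_d] := branch Z u v (subset_trans sZY1 sY1Y) sXZ Zu Zv
  (X'conf u v Zv uv) (X'conf v u Zu (etrans (conflict_sym G v u) uv)) uv.
rewrite (GIS_between_branch X Zu uv).
apply: runs_bind (runs_op _ _) _ => _ <-.
(* The time left is [n + (n + d)]: [d] is split between the two recursive calls, and each [n] pays
   for one set update before the second. *)
apply: (@runs_le _ _ _ (call_cost * calls #|Y :\: X|.-1 +
  (n + (n + call_cost * calls #|Y :\: X|.-2)))); first by move: le_d; lia.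
apply: runs_bind runs1 _ => _ <-.
case: (GIS_between X (Z :\ u)) => /=; first exact: runs_ret.
apply: runs_bind (runs_op _ _) _ => _ <-.
by apply: runs_bind (runs_op _ _) _ => _ <-.
Qed.

Lemma runs_algorithm_B fuel : n < fuel ->
  runs (algorithm_B G fuel) (eq (GIS_between set0 setT))
       (2 * n + call_cost * calls n).
Proof.
move=> ltn; apply: runs_charge.
have := @runs_las_vegas fuel set0 setT (sub0set _).
by rewrite setD0 cardsT; apply.
Qed.

Lemma GIS_between0T : GIS_between set0 setT <-> CIS G.
Proof.
split=> [/GIS_betweenP[S [gisS _ _]] | [S gisS]]; first by exists S.
by apply/GIS_betweenP; exists S; rewrite sub0set subsetT.
Qed.

End GraphSystem.

(** * Exponential bounds *)

Import Order.TTheory GRing.Theory Num.Theory.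
Local Open Scope ring_scope.

(** Adding 1 to [calls] makes its recurrence homogeneous, so the hypothesis on [a] closes an
    induction over two consecutive indices. The factor 2 is the value at [k = 0]. *)
Lemma calls_le_exp (R : realFieldType) (a : R) k : 1 <= a -> a + 1 <= a ^+ 2 ->
  (calls k)%:R + 1 <= 2 * a ^+ k.
Proof.
move=> a_ge1 a2.
suff: (calls k)%:R + 1 <= 2 * a ^+ k /\ (calls k.+1)%:R + 1 <= 2 * a ^+ k.+1.
  by case.
elim: k => [|k [IHk IHk1]]; first by rewrite expr0 expr1 /=; split; lra.
split=> //; rewrite callsSS !natrD.
have ak : 0 <= a ^+ k by rewrite exprn_ge0; lra.
have := ler_wpM2l ak a2.
move: IHk IHk1; rewrite !exprSr; lra.
Qed.

(* Each linear factor is absorbed through Bernoulli's inequality by raising the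
   base to the midpoint of [a] and [b]. *)
Lemma poly_mul_exp_le (R : archiRealFieldType) k (a b : R) : 0 < a -> a < b ->
  exists C : nat, forall n, n.+1%:R ^+ k * a ^+ n <= C%:R * b ^+ n.
Proof.
elim: k a b => [|k IHk] a b a_gt0 ltab.
  by exists 1%N => n; rewrite expr0 !mul1r lerXn2r ?nnegrE ?ltW //; lra.
have [ltac ltcb] : a < (a + b) / 2 /\ (a + b) / 2 < b by lra.
move: ((a + b) / 2) ltac ltcb => c ltac ltcb.
have [C leC] := IHk a c a_gt0 ltac.
have c_gt0 : 0 < c by apply: lt_trans ltac.
have e_gt0 : 0 < b / c - 1 by rewrite subr_gt0 ltr_pdivlMr ?mul1r.
set e := b / c - 1 in e_gt0.
(* This choice gives both [1 <= D] and [1 <= D * e], the base and the increment of the induction for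
   [leDn]. *)
have [D leD] : exists D : nat, 1 + e^-1 <= D%:R.
  exists (Num.bound (1 + e^-1)); apply/ltW/archi_boundP.
  by rewrite addr_ge0 ?invr_ge0 // ltW.
have D_ge1 : 1 <= D%:R :> R by apply: le_trans leD; rewrite lerDl invr_ge0 ltW.
have De_ge1 : 1 <= D%:R * e.
  by rewrite -ler_pdivrMr // mul1r; apply: le_trans leD; rewrite lerDr.
have leDn n : n.+1%:R <= D%:R * (b / c) ^+ n.
  elim: n => [|n IHn]; first by rewrite expr0 mulr1.
  have bn_ge1 : 1 <= (b / c) ^+ n by rewrite exprn_ege1 // -subr_ge0 ltW.
  have ->: (b / c) ^+ n.+1 = (b / c) ^+ n + (b / c) ^+ n * e.
    by rewrite exprSr /e; ring.
  by rewrite -natr1 mulrDr lerD // mulrCA mulr_ege1.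
exists (D * C)%N => n; rewrite exprS -mulrA.
have bE : b ^+ n = (b / c) ^+ n * c ^+ n by rewrite -exprMn divfK // gt_eqF.
apply: le_trans (ler_wpM2l (ler0n _ _) (leC n)) _.
rewrite natrM bE (_ : D%:R * C%:R * _ = D%:R * (b / c) ^+ n * (C%:R * c ^+ n)); last ring.
by rewrite ler_wpM2r // mulr_ge0 ?exprn_ge0 // ltW.
Qed.

(** * Assembly of the time bound *)

Lemma delta1E : delta1 = 16181 / 10000.
Proof. by rewrite -[LHS]divq_num_den; congr (_ / _). Qed.

(** The initial [2 * #|V|] is absorbed by one extra call, which yields exactly the [calls + 1]
    bounded by [calls_le_exp]. *)
Lemma time_le (V : finType) (G : graph_system V) :
  (2 * #|V| + call_cost G * calls #|V|
   <= 40 * ndir G * #|V|.+1 ^ 3 * (calls #|V|).+1)%N.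
Proof.
have := leq_mul (call_cost_le G) (leqnn (calls #|V|)).
suff : (2 * #|V| <= 40 * ndir G * #|V|.+1 ^ 3)%N by lia.
have := ndir_gt0 G; rewrite !expnS; nia.
Qed.

Local Close Scope ring_scope.

Theorem theorem2p3 :
  exists C k : nat, forall (V : finType) (G : graph_system V),
  exists fuel0 : nat, forall fuel : nat, fuel0 <= fuel ->
    algorithm_B G fuel <> [::] /\
    (forall (r : option bool) (t : nat), (r, t) \in algorithm_B G fuel ->
       (exists b : bool, r = Some b /\ (b = true <-> CIS G)) /\
       (t%:R <= C%:R * (ndir G)%:R ^+ k * delta1 ^+ #|V| :> rat)%R).
Proof.
have [a [a_ge1 a2 lta]] :
    exists a : rat, [/\ 1 <= a, a + 1 <= a ^+ 2 & a < delta1]%R.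
  (* A ratio of consecutive Fibonacci numbers, just above the golden ratio. *)
  by exists (233 / 144)%R; rewrite delta1E; split; lra.
(* The exponent 3 is that of [#|V|.+1] in the cost of one call. *)
have [C leC] := poly_mul_exp_le 3 (lt_le_trans ltr01 a_ge1) lta.
(* The constant 80 is the 40 of [time_le] times the 2 of [calls_le_exp]; [ndir G] enters linearly;
   the recursion starts from the full vertex set, so the fuel must exceed [#|V|]. *)
exists (80 * C), 1 => V G; exists #|V|.+1 => fuel ltV.
have [runs0 runsP] := runs_algorithm_B G ltV; split=> // r t /runsP.
case=> _ [/= -> <- le_t]; split.
  by exists (GIS_between G set0 setT); split=> //; apply: GIS_between0T.
have := leq_trans le_t (time_le G).
rewrite -(ler_nat rat) natrM (natrM _ _ (_ ^ 3)) natrX natrM.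
rewrite -[(calls _).+1%:R%R]natr1 expr1 => /le_trans; apply.
have := calls_le_exp #|V| a_ge1 a2; have := leC #|V|.
rewrite (natrM _ 80); move: (#|V|.+1%:R ^+ 3)%R (exprn_ge0 3 (ler0n rat #|V|.+1)).
move: (a ^+ _)%R (delta1 ^+ _)%R (calls _)%:R%R => x y c N3 N3_ge0 leN3 lec.
have m_ge0 := ler0n rat (ndir G).
have := ler_wpM2l m_ge0 leN3; have := ler_wpM2l (mulr_ge0 m_ge0 N3_ge0) lec.
lra.
Qed.
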